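(* Let $\widehat\Sigma\in\mathbb{R}^{n\times n}$ be symmetric strictly positive definite, partitioned as $\widehat\Sigma=\begin{pmatrix}\widehat\Sigma_{11}&\widehat\Sigma_{12}\\ \widehat\Sigma_{21}&\widehat\Sigma_{22}\end{pmatrix}$ with $\widehat\Sigma_{ii}$ of size $n_i\times n_i$, $n_1+n_2=n$. Let $H=\begin{pmatrix}H_1\\H_2\end{pmatrix}$ with $H_1\in\mathbb{R}^{n_1\times k}$, $H_2\in\mathbb{R}^{n_2\times k}$, $H_2H_2^\top>0$, and $D=\begin{pmatrix}D_1&0\\0&0\end{pmatrix}$ with $D_1\in\mathbb{R}^{n_1\times n_1}$ diagonal, $D_1>0$. Put $$\widetilde H_1=H_1\big(I-H_2^\top(H_2H_2^\top)^{-1}H_2\big),\qquad \widetilde\Sigma_{11}=\widehat\Sigma_{11}-\widehat\Sigma_{12}\widehat\Sigma_{22}^{-1}\widehat\Sigma_{21}.$$ If $(H,D)$ is a stationary point of the alternating minimization algorithm, then $$\mathcal I(\widehat\Sigma\|HH^\top+D)=\mathcal I(\widetilde\Sigma_{11}\|\widetilde H_1\widetilde H_1^\top+D_1).$$ Moreover, the stationary equations $H=\widehat\Sigma(HH^\top+D)^{-1}H$, $D=\Delta(\widehat\Sigma-HH^\top)$ reduce to the equations $$\widetilde H_1=\widetilde\Sigma_{11}(\widetilde H_1\widetilde H_1^\top+D_1)^{-1}\widetilde H_1=(\widetilde\Sigma_{11}-\widetilde H_1\widetilde H_1^\top)D_1^{-1}\widetilde H_1,\qquad D_1=\Delta(\widetilde\Sigma_{11}-\widetilde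 H_1\widetilde H_1^\top),$$ which are satisfied by $(\widetilde H_1,D_1)$.
   Context: $k<n$. For strictly positive definite $m\times m$ matrices, $\mathcal I(\Sigma_1\|\Sigma_2)=\frac12\log\frac{|\Sigma_2|}{|\Sigma_1|}-\frac m2+\frac12\mathrm{tr}(\Sigma_2^{-1}\Sigma_1)$. For a square matrix $M$, $\Delta(M)$ is the diagonal matrix with the same diagonal as $M$. The alternating minimization algorithm maps a pair $(H,D)$, with $H\in\mathbb{R}^{n\times k}$, $D\ge0$ diagonal and $HH^\top+D$ invertible, to the pair $(H',D')$ given by $$H'=\widehat\Sigma(HH^\top+D)^{-1}HR^{-1/2},\qquad D'=\Delta(\widehat\Sigma-H'H'^\top),$$ $$R=I-H^\top(HH^\top+D)^{-1}H+H^\top(HH^\top+D)^{-1}\widehat\Sigma(HH^\top+D)^{-1}H,$$ where $R^{-1/2}$ is the inverse of the symmetric positive definite square root of the (strictly positive definite) matrix $R$. A stationary point is a pair $(H,D)$ with $(H',D')=(H,D)$. *)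

(* Defs.v *)
From mathcomp Require Import all_boot all_order all_algebra.
From mathcomp Require Import all_classical all_reals all_analysis.

Set Implicit Arguments.
Unset Strict Implicit.
Unset Printing Implicit Defensive.

Import Order.TTheory GRing.Theory Num.Theory.
Local Open Scope classical_set_scope.
Local Open Scope ring_scope.

Definition posdef (R : realType) (m : nat) (A : 'M[R]_m) : Prop :=
  A^T = A /\ forall x : 'cV[R]_m, x != 0 -> 0 < (x^T *m A *m x) ord0 ord0.

(* The Kullback-Leibler divergence between the centered normal laws with
   covariances S1 and S2; meaningful for positive definite S1 and S2. *)
Definition Idiv (R : realType) (m : nat) (S1 S2 : 'M[R]_m) : R :=
  2^-1 * ln (\det S2 / \det S1) - m%:R / 2 + 2^-1 * \tr (invmx S2 *m S1).

Definition diag_part (R : realType) (m : nat) (M : 'M[R]_m) : 'M[R]_m :=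
  diag_mx (\row_i M i i).

(* For positive definite A the set below is a singleton; the value 0 is only
   taken on matrices without a positive definite square root. *)
Definition sqrt_mx (R : realType) (m : nat) (A : 'M[R]_m) : 'M[R]_m :=
  xget 0 [set B : 'M[R]_m | posdef B /\ B *m B = A].

Section AlternatingMinimization.
Variables (R : realType) (n k : nat) (Sigma : 'M[R]_n).
Implicit Types (H : 'M[R]_(n, k)) (D : 'M[R]_n).

Definition model_cov H D : 'M[R]_n := H *m H^T + D.

Definition altmin_R H D : 'M[R]_k :=
  let K := invmx (model_cov H D) in
  1%:M - H^T *m K *m H + H^T *m K *m Sigma *m K *m H.

Definition altmin_dom H D : Prop :=
  [/\ is_diag_mx D, forall i, 0 <= D i i & model_cov H D \in unitmx].

Definition altmin_map (p : 'M[R]_(n, k) * 'M[R]_n) : 'M[R]_(n, k) * 'M[R]_n :=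
  let: (H, D) := p in
  let H' := Sigma *m invmx (model_cov H D) *m H *m invmx (sqrt_mx (altmin_R H D)) in
  (H', diag_part (Sigma - H' *m H'^T)).

Definition stationary_point H D : Prop :=
  altmin_dom H D /\ altmin_map (H, D) = (H, D).

Definition stationary_eqs H D : Prop :=
  H = Sigma *m invmx (model_cov H D) *m H /\ D = diag_part (Sigma - H *m H^T).

End AlternatingMinimization.

(* Main.v *)
Require Import Defs.
From mathcomp Require Import all_boot all_order all_algebra.
From mathcomp Require Import all_classical all_reals all_analysis.

Set Implicit Arguments.
Unset Strict Implicit.
Unset Printing Implicit Defensive.

Import Order.TTheory GRing.Theory Num.Theory.
Local Open Scope ring_scope.

(** Write [M = H H^T + D] and [K = M^-1].

    A fixed point of the algorithm satisfies [H S = Sigma K H] with [S] the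
    positive definite root of [R].  Multiplying by [H^T K] on the left and
    inserting the definition of [R = S^2] turns this into
    [(S + (1 - H^T K H)) (S - 1) = 0].  Since [D >= 0], the matrix
    [1 - H^T K H] has a nonnegative quadratic form, so the first factor is
    invertible and [S = 1]: the stationary equations hold
    ([stationary_point_eqs], [nneg_form_resolvent_gap]).

    The stationary equation [H = Sigma K H], multiplied by [H^T] on the right,
    gives [Sigma - H H^T = Sigma K D].  As [D] vanishes on the second block of
    columns, the second block of columns of [Sigma] is that of [H H^T], which
    is that of [M] ([stationary_eq_blocks]).  By symmetry, [Sigma] and [M]
    share their blocks outside position (1,1), and the difference [E] of their
    (1,1) blocks is also the difference of their Schur complements, which are
    [Sigma11t] and [S1 = H1t H1t^T + D1] ([schur_model_cov]).

    From here on, [Sigma] enters through [E].  The equation [H = Sigma K H]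
    says that [Sigma - M] annihilates [K H]; the top block of [K H] is
    [S1^-1 H1t], so it says [E S1^-1 H1t = 0], which is the first reduced
    equation ([stationary_eq_schur]) and implies the second
    ([reduced_eq_noise]).  The only nonzero block of [Sigma - H H^T] is
    [E + D1 = Sigma11t - H1t H1t^T], so the two equations for the diagonal
    agree ([stationary_diag_schur]).  In the divergence, the determinant of
    the common (2,2) block cancels, and [tr (K Sigma) - (n1 + n2)] and
    [tr (S1^-1 Sigma11t) - n1] are both [tr (S1^-1 E)] ([Idiv_schur]). *)

(** * Schur complements *)

Section Schur.
Variables (F : fieldType) (m n : nat).
Implicit Types (A : 'M[F]_m) (B : 'M[F]_(m, n)) (C : 'M[F]_(n, m)).
Implicit Types (W : 'M[F]_n).

Definition schur A B C W := A - B *m invmx W *m C.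

(** Block elimination of [B] factors the matrix as a unit upper triangular
    matrix times a lower triangular one. *)
Lemma det_schur A B C W : W \in unitmx ->
  \det (block_mx A B C W) = \det (schur A B C W) * \det W.
Proof.
move=> uW.
have -> : block_mx A B C W
    = block_mx 1%:M (B *m invmx W) 0 1%:M *m block_mx (schur A B C W) 0 C W.
  by rewrite mulmx_block !mul1mx !mul0mx !add0r mulmxKV // /schur addrNK.
by rewrite det_mulmx det_ublock !det1 mulr1 mul1r det_lblock.
Qed.

Lemma unitmx_schur A B C W : W \in unitmx -> schur A B C W \in unitmx ->
  block_mx A B C W \in unitmx.
Proof.
by move=> uW; rewrite !unitmxE det_schur // unitrM -!unitmxE uW andbT.
Qed.

Lemma usubmx_inv_schur A B C W :
    W \in unitmx -> schur A B C W \in unitmx ->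
  usubmx (invmx (block_mx A B C W))
    = row_mx (invmx (schur A B C W))
             (- (invmx (schur A B C W) *m B *m invmx W)).
Proof.
move=> uW uS; set S := schur A B C W; set M := block_mx _ _ _ _.
have uM : M \in unitmx by apply: unitmx_schur.
have top_mulM : row_mx (invmx S) (- (invmx S *m B *m invmx W)) *m M
    = row_mx 1%:M 0.
  rewrite /M mul_row_block !mulNmx mulmxKV // subrr.
  by rewrite -!mulmxA -mulmxBr mulmxA mulVmx.
rewrite -[RHS](mulmxK uM) top_mulM -[in RHS](vsubmxK (invmx M)).
by rewrite mul_row_col mul1mx mul0mx addr0.
Qed.

Lemma schur_subl A A' B C W : schur A B C W - schur A' B C W = A - A'.
Proof. by rewrite /schur opprB addrA addrNK. Qed.

(** Perturbing only the (1,1) block perturbs the Schur complement by the same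
    amount [E], and both traces exceed the dimension by the trace of
    [(schur A B C W)^-1 E]. *)
Lemma mxtrace_inv_schur A A' B C W :
    W \in unitmx -> schur A B C W \in unitmx ->
  \tr (invmx (block_mx A B C W) *m block_mx A' B C W)
    = \tr (invmx (schur A B C W) *m schur A' B C W) + n%:R.
Proof.
move=> uW uS; have uM := unitmx_schur uW uS.
have -> : block_mx A' B C W = block_mx A B C W + block_mx (A' - A) 0 0 0.
  by rewrite add_block_mx !addr0 addrC subrK.
have -> : schur A' B C W = schur A B C W + (A' - A).
  by rewrite -(schur_subl A' A B C W) addrC subrK.
move: (A' - A) => E; rewrite mulmxDr mulVmx // [in RHS]mulmxDr (mulVmx uS).
rewrite !mxtraceD !mxtrace1 natrD -!addrA; congr (_ + _).
rewrite [RHS]addrC; congr (_ + _).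
rewrite -[invmx (block_mx _ _ _ _)]vsubmxK usubmx_inv_schur //.
rewrite -[dsubmx _]hsubmxK -/(block_mx _ _ _ _) mulmx_block !mulmx0 !addr0.
by rewrite mxtrace_block mxtrace0 addr0.
Qed.

End Schur.

Lemma Idiv_schur (R : realType) (m n : nat) (A A' : 'M[R]_m)
    (B : 'M[R]_(m, n)) (C : 'M[R]_(n, m)) (W : 'M[R]_n) :
    W \in unitmx -> schur A B C W \in unitmx ->
  Idiv (block_mx A' B C W) (block_mx A B C W)
    = Idiv (schur A' B C W) (schur A B C W).
Proof.
move=> uW uS; rewrite /Idiv !det_schur // mxtrace_inv_schur //.
have dW : \det W != 0 by rewrite -unitfE -unitmxE.
rewrite -mulf_div divff // mulr1 natrD mulrDl mulrDr [2^-1 * n%:R]mulrC.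
by rewrite opprD -!addrA; congr (_ + (_ + _)); rewrite addrCA addNr addr0.
Qed.

(** * Positive definite matrices *)

Section Posdef.
Variable R : realType.

(** Nonnegativity of the quadratic form, without symmetry: it only serves to
    prove that sums with a positive definite matrix are invertible. *)
Definition nneg_form (m : nat) (A : 'M[R]_m) :=
  forall x : 'cV[R]_m, 0 <= (x^T *m A *m x) ord0 ord0.

Lemma pos_form_unitmx (m : nat) (A : 'M[R]_m) :
    (forall x : 'cV[R]_m, x != 0 -> 0 < (x^T *m A *m x) ord0 ord0) ->
  A \in unitmx.
Proof.
move=> pA; rewrite unitmxE unitfE; apply/negP => /det0P[v v0 vA].
have vT0 : v^T != 0.
  by apply: contraNneq v0 => /(congr1 trmx); rewrite trmxK trmx0 => ->.
by have := pA _ vT0; rewrite trmxK vA mul0mx mxE ltxx.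
Qed.

Lemma posdef_unitmx (m : nat) (A : 'M[R]_m) : posdef A -> A \in unitmx.
Proof. by case=> _ /pos_form_unitmx. Qed.

Lemma posdef_addr_unitmx (m : nat) (A B : 'M[R]_m) :
  posdef A -> nneg_form B -> A + B \in unitmx.
Proof.
move=> [_ pA] pB; apply: pos_form_unitmx => x x0.
by rewrite mulmxDr mulmxDl mxE ltr_wpDr ?pA.
Qed.

Lemma nneg_form_gram (m p : nat) (A : 'M[R]_(m, p)) : nneg_form (A *m A^T).
Proof.
move=> x; rewrite mulmxA -mulmxA -{1}[A]trmxK -trmx_mul mxE.
by apply: sumr_ge0 => i _; rewrite mxE -expr2 sqr_ge0.
Qed.

Lemma nneg_form_add (m : nat) (A B : 'M[R]_m) :
  nneg_form A -> nneg_form B -> nneg_form (A + B).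
Proof. by move=> pA pB x; rewrite mulmxDr mulmxDl mxE addr_ge0. Qed.

Lemma nneg_form_congr (m p : nat) (A : 'M[R]_m) (B : 'M[R]_(m, p)) :
  nneg_form A -> nneg_form (B^T *m A *m B).
Proof. by move=> pA x; have := pA (B *m x); rewrite trmx_mul !mulmxA. Qed.

Lemma nneg_form_diag (m : nat) (D : 'M[R]_m) :
  is_diag_mx D -> (forall i, 0 <= D i i) -> nneg_form D.
Proof.
move=> /diag_mxP[d ->] d0 x; rewrite -mulmxA mxE.
apply: sumr_ge0 => i _; rewrite mul_diag_mx !mxE mulrCA -expr2.
by rewrite mulr_ge0 ?sqr_ge0 //; have := d0 i; rewrite mxE eqxx.
Qed.

End Posdef.

(** * Fixed points of the algorithm satisfy the stationary equations *)

Section Stationary.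
Variables (R : realType) (n k : nat).
Implicit Types (H : 'M[R]_(n, k)) (D Sigma : 'M[R]_n).

(** With [K] the inverse of [H H^T + D] and [G = H^T K H], one has
    [G^2 = H^T K (K^-1 - D) K H = G - (K H)^T D (K H)], so that
    [1 - G = (1 - G)^2 + (K H)^T D (K H)] is a sum of squares. *)
Lemma nneg_form_resolvent_gap H D : D^T = D -> nneg_form D ->
    model_cov H D \in unitmx ->
  nneg_form (1%:M - H^T *m invmx (model_cov H D) *m H).
Proof.
move=> symD pD uM; set K := invmx _; set G := H^T *m K *m H.
have symK : K^T = K.
  by rewrite trmx_inv /model_cov linearD /= trmx_mul trmxK symD.
have symG : G^T = G by rewrite /G !trmx_mul trmxK symK mulmxA.
have GG : G *m G = G - (K *m H)^T *m D *m (K *m H).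
  have HHT : H *m H^T = model_cov H D - D by rewrite /model_cov addrK.
  rewrite trmx_mul symK /G -!mulmxA (mulmxA H) HHT mulmxBl mulKVmx //.
  by rewrite !mulmxBr.
have -> : 1%:M - G
    = (1%:M - G) *m (1%:M - G)^T + (K *m H)^T *m D *m (K *m H).
  rewrite linearB /= trmx1 symG mulmxBl mul1mx mulmxBr mulmx1 GG.
  by rewrite subKr addrNK.
by apply: nneg_form_add; [apply: nneg_form_gram | apply: nneg_form_congr].
Qed.

Lemma invmx0 m : invmx (0 : 'M[R]_m) = 0.
Proof.
rewrite /invmx; case: ifP => // u0.
have e : (1%:M : 'M[R]_m) = 0 by rewrite -(mulmxV u0) mul0mx.
by rewrite -[LHS]mulmx1 e mulmx0.
Qed.

(** With [T] the root of [R] and [Q = 1 - H^T K H], the fixed point equation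
    [H T = Sigma K H] gives [Q T = T - X], where [X = H^T K Sigma K H], while
    [T^2 = R = Q + X].  Adding, [(T + Q) T = T + Q], and [T + Q] is
    invertible. *)
Lemma stationary_point_eqs Sigma H D :
  stationary_point Sigma H D -> stationary_eqs Sigma H D.
Proof.
case=> -[diagD D_ge0 uM] /=; set K := invmx _; set T := sqrt_mx _.
move=> [fixH fixD]; rewrite fixH in fixD; split; last by [].
have : (posdef T /\ T *m T = altmin_R Sigma H D) \/ T = 0.
  rewrite /T /sqrt_mx; case: xgetP => [B _ ?|_]; by [left | right].
(* Without a root, the update of [H] degenerates to 0, and a fixed point
   has [H = 0], for which the equation is trivial. *)
case=> [[pT TT]|T0]; last first.
  by rewrite T0 invmx0 mulmx0 in fixH; rewrite -fixH mulmx0.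
have symD : D^T = D.
  by case/diag_mxP: diagD => d ->; rewrite tr_diag_mx.
have HT : H *m T = Sigma *m K *m H.
  by rewrite -{1}fixH mulmxKV // posdef_unitmx.
set Q := 1%:M - H^T *m K *m H.
set X := H^T *m K *m Sigma *m K *m H.
have QT : Q *m T = T - X.
  by rewrite mulmxBl mul1mx -!mulmxA HT /X !mulmxA.
have factor0 : (T + Q) *m (T - 1%:M) = 0.
  rewrite mulmxBr mulmx1 mulmxDl QT TT -[altmin_R _ _ _]/(Q + X).
  by rewrite addrACA subrr addr0 [Q + T]addrC subrr.
have uTG : T + Q \in unitmx.
  apply: posdef_addr_unitmx => //; apply: nneg_form_resolvent_gap => //.
  exact: nneg_form_diag.
have /eqP : T - 1%:M = 0 by rewrite -[LHS](mulKmx uTG) factor0 mulmx0.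
by rewrite subr_eq0 => /eqP T1; rewrite -HT T1 mulmx1.
Qed.

End Stationary.

(** * Elimination of the block without noise *)

Section Reduction.
Variables (R : realType) (n1 n2 k : nat)
  (H1 : 'M[R]_(n1, k)) (H2 : 'M[R]_(n2, k)) (D1 : 'M[R]_n1).

Let W := H2 *m H2^T.
Let H : 'M[R]_(n1 + n2, k) := col_mx H1 H2.
Let D : 'M[R]_(n1 + n2) := block_mx D1 0 0 0.
Let H1t := H1 *m (1%:M - H2^T *m invmx W *m H2).
Let S1 := H1t *m H1t^T + D1.

Lemma mul_col_mx_tr : H *m H^T
  = block_mx (H1 *m H1^T) (H1 *m H2^T) (H2 *m H1^T) W.
Proof. by rewrite /H tr_col_mx mul_col_row. Qed.

Lemma model_cov_block : model_cov H D
  = block_mx (H1 *m H1^T + D1) (H1 *m H2^T) (H2 *m H1^T) W.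
Proof. by rewrite /model_cov mul_col_mx_tr add_block_mx !addr0. Qed.

Lemma H1tE : H1t = H1 - H1 *m H2^T *m invmx W *m H2.
Proof. by rewrite /H1t mulmxBr mulmx1 !mulmxA. Qed.

Hypothesis uW : W \in unitmx.

(** [H1t] is [H1] times the orthogonal projection onto the kernel of [H2],
    hence [H2 H1t^T = 0] and [H1t H1t^T = H1 H1t^T]. *)
Lemma reduced_gram :
  H1t *m H1t^T = schur (H1 *m H1^T) (H1 *m H2^T) (H2 *m H1^T) W.
Proof.
have symW : W^T = W by rewrite /W trmx_mul trmxK.
have H2H1t : H2 *m H1t^T = 0.
  rewrite H1tE linearB /= !trmx_mul !trmxK trmx_inv symW mulmxBr !mulmxA.
  by rewrite -/W mulmxV // mul1mx subrr.
rewrite {1}H1tE mulmxBl -(mulmxA _ H2) H2H1t mulmx0 subr0 H1tE.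
by rewrite linearB /= mulmxBr !trmx_mul !trmxK trmx_inv symW /schur !mulmxA.
Qed.

Lemma schur_model_cov :
  schur (H1 *m H1^T + D1) (H1 *m H2^T) (H2 *m H1^T) W = S1.
Proof. by rewrite /S1 reduced_gram /schur addrAC. Qed.

Hypothesis uS1 : S1 \in unitmx.

Lemma model_cov_unitmx : model_cov H D \in unitmx.
Proof. by rewrite model_cov_block unitmx_schur ?schur_model_cov. Qed.

Lemma usubmx_inv_model_cov_mul :
  usubmx (invmx (model_cov H D) *m H) = invmx S1 *m H1t.
Proof.
rewrite -mul_usub_mx model_cov_block usubmx_inv_schur ?schur_model_cov //.
by rewrite /H mul_row_col mulNmx H1tE mulmxBr !mulmxA.
Qed.

(** The equation [H = Sigma K H] is [(Sigma - M) K H = 0], and here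
    [Sigma - M] only has a (1,1) block, which is the difference of the Schur
    complements. *)
Lemma stationary_eq_schur (A : 'M[R]_n1) :
  let Sigma := block_mx A (H1 *m H2^T) (H2 *m H1^T) W in
  let T := schur A (H1 *m H2^T) (H2 *m H1^T) W in
  H = Sigma *m invmx (model_cov H D) *m H <-> H1t = T *m invmx S1 *m H1t.
Proof.
move=> Sigma T.
have SigmaE : Sigma = model_cov H D + block_mx (T - S1) 0 0 0.
  rewrite -schur_model_cov schur_subl model_cov_block add_block_mx !addr0.
  by rewrite subrKC.
have -> : Sigma *m invmx (model_cov H D) *m H
    = H + col_mx ((T - S1) *m (invmx S1 *m H1t)) 0.
  rewrite SigmaE -mulmxA mulmxDl mulKVmx ?model_cov_unitmx //; congr (_ + _).
  rewrite -[invmx _ *m H]vsubmxK usubmx_inv_model_cov_mul mul_block_col.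
  by rewrite !mul0mx !addr0.
have -> : T *m invmx S1 *m H1t = H1t + (T - S1) *m (invmx S1 *m H1t).
  by rewrite (mulmxBl T S1) mulKVmx // subrKC (mulmxA T).
split=> /eqP; rewrite eq_sym -subr_eq0 addrAC subrr add0r => /eqP.
  by move=> /(congr1 usubmx); rewrite col_mxKu linear0 => ->; rewrite addr0.
by move=> ->; rewrite col_mx0 addr0.
Qed.

(** Since [S1 D1^-1 H1t = H1t (H1t^T D1^-1 H1t + 1)], any matrix annihilating
    [S1^-1 H1t] annihilates [D1^-1 H1t] as well; this is applied to
    [T - S1]. *)
Lemma reduced_eq_noise (T : 'M[R]_n1) : D1 \in unitmx ->
    H1t = T *m invmx S1 *m H1t ->
  T *m invmx S1 *m H1t = (T - H1t *m H1t^T) *m invmx D1 *m H1t.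
Proof.
move=> uD1 eqT; rewrite -eqT.
have E0 : (T - S1) *m (invmx S1 *m H1t) = 0.
  by rewrite mulmxBl mulKVmx // (mulmxA T) -eqT subrr.
have D1H : invmx D1 *m H1t
    = invmx S1 *m H1t *m (H1t^T *m invmx D1 *m H1t + 1%:M).
  rewrite -[LHS](mulKmx uS1) -[RHS]mulmxA; congr (_ *m _).
  rewrite mulmxDl mulKVmx // (mulmxDr H1t) mulmx1.
  by rewrite !(mulmxA H1t) (mulmxA (H1t *m H1t^T)).
have -> : T - H1t *m H1t^T = (T - S1) + D1 by rewrite /S1 opprD addrA addrNK.
by rewrite -mulmxA mulmxDl mulKVmx // D1H mulmxA E0 mul0mx add0r.
Qed.

(** Multiplying the first stationary equation by [H^T] on the right gives
    [Sigma - H H^T = Sigma K D], and [D] has no second block of columns. *)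
Lemma stationary_eq_blocks (Sigma : 'M[R]_(n1 + n2)) :
    H = Sigma *m invmx (model_cov H D) *m H ->
  ursubmx Sigma = H1 *m H2^T /\ drsubmx Sigma = W.
Proof.
set K := invmx _ => eqH.
have diffE : Sigma - H *m H^T = Sigma *m K *m D.
  have -> : D = model_cov H D - H *m H^T by rewrite /model_cov addrC addKr.
  by rewrite mulmxBr mulmxKV ?model_cov_unitmx // mulmxA -eqH.
have -> : Sigma = H *m H^T + Sigma *m K *m D by rewrite -diffE subrKC.
rewrite -[Sigma *m K]submxK mulmx_block !mulmx0 !addr0 mul_col_mx_tr.
by rewrite add_block_mx block_mxKur block_mxKdr !addr0.
Qed.

Lemma diag_part_corner (A : 'M[R]_n1) :
  diag_part (block_mx A 0 0 0 : 'M[R]_(n1 + n2))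
    = block_mx (diag_part A) 0 0 0.
Proof.
apply/matrixP=> i j; rewrite [LHS]mxE [X in X *+ _]mxE.
case: (split_ordP i) => a ->; case: (split_ordP j) => b ->;
  rewrite ?block_mxEul ?block_mxEur ?block_mxEdl ?block_mxEdr.
- by rewrite !mxE (inj_eq (@lshift_inj _ _)).
- by rewrite eq_lrshift mulr0n mxE.
- by rewrite eq_rlshift mulr0n mxE.
- by rewrite !mxE mul0rn.
Qed.

Lemma stationary_diag_schur (A : 'M[R]_n1) :
  let Sigma := block_mx A (H1 *m H2^T) (H2 *m H1^T) W in
  let T := schur A (H1 *m H2^T) (H2 *m H1^T) W in
  D = diag_part (Sigma - H *m H^T) <-> D1 = diag_part (T - H1t *m H1t^T).
Proof.
move=> Sigma T; rewrite reduced_gram schur_subl.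
have -> : Sigma - H *m H^T = block_mx (A - H1 *m H1^T) 0 0 0.
  by rewrite mul_col_mx_tr opp_block_mx add_block_mx !subrr.
by rewrite diag_part_corner /D; split=> [/eq_block_mx[]//|-> //].
Qed.

End Reduction.

Theorem proposition7p2 (R : realType) (n1 n2 k : nat)
    (Sigma : 'M[R]_(n1 + n2))
    (H1 : 'M[R]_(n1, k)) (H2 : 'M[R]_(n2, k)) (D1 : 'M[R]_n1)
    (lt_kn : (k < n1 + n2)%N)
    (Sigma_pos : posdef Sigma)
    (H2_pos : posdef (H2 *m H2^T))
    (D1_diag : is_diag_mx D1) (D1_pos : posdef D1) :
  let H : 'M[R]_(n1 + n2, k) := col_mx H1 H2 in
  let D : 'M[R]_(n1 + n2) := block_mx D1 0 0 0 in
  let Sigma11 := ulsubmx Sigma in let Sigma12 := ursubmx Sigma in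
  let Sigma21 := dlsubmx Sigma in let Sigma22 := drsubmx Sigma in
  let H1t := H1 *m (1%:M - H2^T *m invmx (H2 *m H2^T) *m H2) in
  let Sigma11t := Sigma11 - Sigma12 *m invmx Sigma22 *m Sigma21 in
  let reduced_eqs :=
    [/\ H1t = Sigma11t *m invmx (H1t *m H1t^T + D1) *m H1t,
        Sigma11t *m invmx (H1t *m H1t^T + D1) *m H1t
          = (Sigma11t - H1t *m H1t^T) *m invmx D1 *m H1t
      & D1 = diag_part (Sigma11t - H1t *m H1t^T)] in
  (stationary_point Sigma H D ->
     [/\ Idiv Sigma (H *m H^T + D) = Idiv Sigma11t (H1t *m H1t^T + D1),
         stationary_eqs Sigma H D
       & reduced_eqs])
  /\ (stationary_eqs Sigma H D <->
        [/\ Sigma12 = H1 *m H2^T, Sigma22 = H2 *m H2^T & reduced_eqs]).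
Proof.
move=> H D Sigma11 Sigma12 Sigma21 Sigma22 H1t Sigma11t reduced_eqs.
have uW := posdef_unitmx H2_pos; have uD1 := posdef_unitmx D1_pos.
have uS1 : H1t *m H1t^T + D1 \in unitmx.
  by rewrite addrC posdef_addr_unitmx //; apply: nneg_form_gram.
have SigmaE : Sigma12 = H1 *m H2^T -> Sigma22 = H2 *m H2^T ->
    Sigma = block_mx Sigma11 (H1 *m H2^T) (H2 *m H1^T) (H2 *m H2^T)
    /\ Sigma11t = schur Sigma11 (H1 *m H2^T) (H2 *m H1^T) (H2 *m H2^T).
  move=> e12 e22; have e21 : Sigma21 = H2 *m H1^T.
    case: Sigma_pos => symS _.
    by rewrite /Sigma21 -symS -trmx_ursub -/Sigma12 e12 trmx_mul trmxK.
  by rewrite /Sigma11t /schur -{1}[Sigma]submxK -/Sigma12 -/Sigma21 -/Sigma22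
    e12 e21 e22.
have eqs_iff : stationary_eqs Sigma H D <->
    [/\ Sigma12 = H1 *m H2^T, Sigma22 = H2 *m H2^T & reduced_eqs].
  split=> [[eqH eqD]|[e12 e22 [eqH1 _ eqD1]]].
    have [e12 e22] := stationary_eq_blocks uW uS1 eqH.
    have [SE TE] := SigmaE e12 e22.
    move: eqH eqD; rewrite SE.
    move=> /(stationary_eq_schur uW uS1 _); rewrite -TE => eqH1.
    move=> /(stationary_diag_schur _ _ uW); rewrite -TE => eqD1.
    by split=> //; split=> //; apply: reduced_eq_noise.
  have [SE TE] := SigmaE e12 e22; split; rewrite SE.
    by apply/(stationary_eq_schur uW uS1 _); rewrite -TE.
  by apply/(stationary_diag_schur _ _ uW); rewrite -TE.
split=> // /stationary_point_eqs eqs.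
have [e12 e22 red] := eqs_iff.1 eqs; split=> //.
have [-> ->] := SigmaE e12 e22.
by rewrite -/(model_cov H D) model_cov_block Idiv_schur ?schur_model_cov.
Qed.
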